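(* Let $R$ be a commutative ring with identity. Then for all nonnegative integers $k$, $$\operatorname{Int}^{(k)}(R,R[\varepsilon])=\operatorname{Int}^{(k)}(R)[\varepsilon]\quad\text{and}\quad \operatorname{Int}^{(k)}(R[\varepsilon])=\operatorname{Int}^{(k+1)}(R)+\operatorname{Int}^{(k)}(R)\,\varepsilon.$$ Moreover, $$\operatorname{Int}^{(\infty)}(R,R[\varepsilon])=\operatorname{Int}^{(\infty)}(R[\varepsilon])=\operatorname{Int}^{(\infty)}(R)[\varepsilon].$$
   Context: All rings are commutative with identity. For a ring $A$, $T(A)$ is its total quotient ring (localization at all non-zerodivisors). For a subset $E\subseteq T(A)$ and a nonnegative integer $k$, $\operatorname{Int}^{(k)}(E,A)=\{f\in T(A)[X]: f^{(j)}(E)\subseteq A\text{ for all }0\le j\le k\}$, where $f^{(j)}$ is the $j$-th formal derivative; $\operatorname{Int}^{(\infty)}(E,A)=\bigcap_{k\ge 0}\operatorname{Int}^{(k)}(E,A)$; and $\operatorname{Int}^{(k)}(A)=\operatorname{Int}^{(k)}(A,A)$ for $k\in\mathbb{Z}_{\ge0}\cup\{\infty\}$. $R[\varepsilon]=R[T]/(T^2)$ is the ring of dual numbers over $R$, with $\varepsilon$ the image of $T$. Its total quotient ring is identified canonically with $T(R)[\varepsilon]$, so that $T(R[\varepsilon])[X]=T(R)[X]\oplus T(R)[X]\varepsilon$, and all the rings above are subsets of this ring. For a subring $B\subseteq T(R)[X]$, $B[\varepsilon]=B+B\varepsilon$. *)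

(* Defs.v *)
From HB Require Import structures.
From mathcomp Require Import all_boot all_order all_algebra.
From mathcomp Require Import boolp classical_sets.
From mathcomp Require Import ring.

Set Implicit Arguments.
Unset Strict Implicit.
Unset Printing Implicit Defensive.

Import GRing.Theory.
Import Pdiv.CommonRing Pdiv.RingMonic.

Local Open Scope classical_set_scope.
Local Open Scope quotient_scope.
Local Open Scope ring_scope.

(* A total quotient ring of A, i.e. a localization A -> T at the multiplicative
   set of all non-zerodivisors. In a commutative ring, [GRing.lreg s] says that
   s is a non-zerodivisor. The kernel of a localization consists of the a with
   s * a = 0 for some s in the multiplicative set, hence the injectivity. *)
Record totalQuotient (A : comNzRingType) := TotalQuotient {
  tq_ring :> comNzRingType;
  tq_map : {rmorphism A -> tq_ring};
  tq_inj : injective tq_map;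
  tq_unit : forall s : A, GRing.lreg s -> exists u, tq_map s * u = 1;
  tq_frac : forall t : tq_ring, exists a s,
    GRing.lreg s /\ t * tq_map s = tq_map a }.

(* The fractions a / s with s a non-zerodivisor form a total quotient ring. *)
Module Fractions.
Section Fractions.
Variable A : comNzRingType.

Definition regb (p : A * A) : bool := `[< GRing.lreg p.2 >].
Record rfrac := RFrac { rfrac_val :> A * A ; _ : regb rfrac_val }.
HB.instance Definition _ := [isSub for rfrac_val].
HB.instance Definition _ := [Choice of rfrac by <:].

Implicit Types x y z : rfrac.

Lemma rfrac_reg x : GRing.lreg x.2.
Proof. by case: x => p rp; apply/asboolP. Qed.

Lemma rfrac_regM x y : regb ((0 : A), x.2 * y.2).
Proof. by apply/asboolP; apply: lregM; apply: rfrac_reg. Qed.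

Definition rf (n d : A) (h : regb (0, d)) : rfrac := @RFrac (n, d) h.

Lemma regb1 : regb ((0 : A), 1). Proof. by apply/asboolP; exact: lreg1. Qed.

Definition eqrf x y := x.1 * y.2 == y.1 * x.2.

Lemma eqrf_refl : reflexive eqrf. Proof. by move=> x; rewrite /eqrf. Qed.
Lemma eqrf_sym : symmetric eqrf.
Proof. by move=> x y; rewrite /eqrf eq_sym. Qed.
Lemma eqrf_trans : transitive eqrf.
Proof.
move=> y x z /eqP xy /eqP yz; apply/eqP; apply: (rfrac_reg (x := y)).
transitivity (x.1 * y.2 * z.2); first by ring.
rewrite xy; transitivity (y.1 * z.2 * x.2); first by ring.
by rewrite yz; ring.
Qed.
Canonical eqrf_equiv := EquivRel eqrf eqrf_refl eqrf_sym eqrf_trans.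

Definition tqr := {eq_quot eqrf}.
HB.instance Definition _ : EqQuotient _ eqrf tqr := EqQuotient.on tqr.
HB.instance Definition _ := Choice.on tqr.

Lemma tqrP x y : \pi_tqr x = \pi_tqr y <-> x.1 * y.2 = y.1 * x.2.
Proof. by split=> [/eqmodP/eqP|/eqP h]; [|apply/eqmodP]. Qed.

Lemma repr_tqr x : (repr (\pi_tqr x)).1 * x.2 = x.1 * (repr (\pi_tqr x)).2.
Proof. by apply/tqrP; rewrite reprK. Qed.

Definition addrf x y := @rf (x.1 * y.2 + y.1 * x.2) _ (rfrac_regM x y).
Definition opprf x := @rf (- x.1) x.2 (valP x).
Definition mulrf x y := @rf (x.1 * y.1) _ (rfrac_regM x y).
Definition torf a := @rf a 1 regb1.

Definition addq (a b : tqr) : tqr := \pi_tqr (addrf (repr a) (repr b)).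
Definition oppq (a : tqr) : tqr := \pi_tqr (opprf (repr a)).
Definition mulq (a b : tqr) : tqr := \pi_tqr (mulrf (repr a) (repr b)).
Definition toq (a : A) : tqr := \pi_tqr (torf a).

Lemma addqE x y : addq (\pi_tqr x) (\pi_tqr y) = \pi_tqr (addrf x y).
Proof.
apply/tqrP => /=; have := repr_tqr x; have := repr_tqr y.
move: (repr (\pi_tqr x)) (repr (\pi_tqr y)) => x' y' ey ex.
transitivity (x'.1 * x.2 * (y'.2 * y.2) + y'.1 * y.2 * (x'.2 * x.2)).
  by ring.
by rewrite ex ey; ring.
Qed.

Lemma oppqE x : oppq (\pi_tqr x) = \pi_tqr (opprf x).
Proof. by apply/tqrP => /=; rewrite !mulNr repr_tqr. Qed.

Lemma mulqE x y : mulq (\pi_tqr x) (\pi_tqr y) = \pi_tqr (mulrf x y).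
Proof. by apply/tqrP => /=; rewrite mulrACA !repr_tqr mulrACA. Qed.

Lemma toqD : {morph toq : a b / a + b >-> addq a b}.
Proof. by move=> a b; rewrite addqE; apply/tqrP => /=; ring. Qed.

Lemma addqA : associative addq.
Proof.
elim/quotW=> x; elim/quotW=> y; elim/quotW=> z.
rewrite (addqE y z) (addqE x) (addqE x y) addqE.
by apply/tqrP => /=; ring.
Qed.

Lemma addqC : commutative addq.
Proof.
by elim/quotW=> x; elim/quotW=> y; rewrite (addqE x y) (addqE y x); apply/tqrP => /=; ring.
Qed.

Lemma add0q : left_id (toq 0) addq.
Proof.
by elim/quotW=> x; rewrite (addqE (torf 0) x); apply/tqrP => /=; ring. Qed.

Lemma addNq : left_inverse (toq 0) oppq addq.
Proof. by elim/quotW=> x; rewrite oppqE addqE; apply/tqrP => /=; ring. Qed.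

HB.instance Definition _ := GRing.isZmodule.Build tqr addqA addqC add0q addNq.

Lemma mulqA : associative mulq.
Proof.
elim/quotW=> x; elim/quotW=> y; elim/quotW=> z.
rewrite (mulqE y z) (mulqE x) (mulqE x y) mulqE.
by apply/tqrP => /=; ring.
Qed.

Lemma mulqC : commutative mulq.
Proof.
by elim/quotW=> x; elim/quotW=> y; rewrite (mulqE x y) (mulqE y x); apply/tqrP => /=; ring.
Qed.

Lemma mul1q : left_id (toq 1) mulq.
Proof. by elim/quotW=> x; rewrite (mulqE (torf 1) x); apply/tqrP => /=; ring. Qed.

Lemma mulqDl : left_distributive mulq addq.
Proof.
elim/quotW=> x; elim/quotW=> y; elim/quotW=> z.
rewrite (addqE x y) (mulqE _ z) (mulqE x z) (mulqE y z) addqE.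
by apply/tqrP => /=; ring.
Qed.

Lemma toq_inj : injective toq.
Proof. by move=> a b /tqrP /=; rewrite !mulr1. Qed.

Lemma oneq_neq0 : toq 1 != toq 0.
Proof. by rewrite (inj_eq toq_inj) oner_eq0. Qed.

HB.instance Definition _ :=
  GRing.Zmodule_isComNzRing.Build tqr mulqA mulqC mul1q mulqDl oneq_neq0.

Lemma toq_zmod_morphism : zmod_morphism toq.
Proof.
move=> a b; rewrite [RHS](_ : _ = addq (toq a) (oppq (toq b))) //.
by rewrite oppqE addqE; apply/tqrP => /=; ring.
Qed.

Lemma toq_monoid_morphism : monoid_morphism toq.
Proof.
split=> // a b; rewrite [RHS](_ : _ = mulq (toq a) (toq b)) //.
by rewrite mulqE; apply/tqrP => /=; ring.
Qed.

HB.instance Definition _ :=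
  GRing.isZmodMorphism.Build A tqr toq toq_zmod_morphism.
HB.instance Definition _ :=
  GRing.isMonoidMorphism.Build A tqr toq toq_monoid_morphism.

Lemma toq_unit (s : A) : GRing.lreg s -> exists u : tqr, toq s * u = 1.
Proof.
move=> rs; have h : regb (0, s) by apply/asboolP.
exists (\pi_tqr (rf 1 h)); rewrite [LHS](mulqE (torf s)).
by apply/tqrP => /=; ring.
Qed.

Lemma toq_frac (t : tqr) : exists a s, GRing.lreg s /\ t * toq s = toq a.
Proof.
elim/quotW: t => x; exists x.1, x.2; split; first exact: rfrac_reg.
by rewrite [LHS](mulqE x); apply/tqrP => /=; ring.
Qed.

Definition fractions : totalQuotient A :=
  @TotalQuotient A tqr toq toq_inj toq_unit toq_frac.

End Fractions.
End Fractions.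


Section Dual.
Variable R : comNzRingType.

Definition dual : comNzRingType := {poly %/ ('X^2 : {poly R})}.
Definition eps : dual := 'qX.
Definition dualC (a : R) : dual := qpolyC 'X^2 a.

Fact dualC_zmod_morphism : zmod_morphism dualC.
Proof. by move=> a b; rewrite /dualC qpolyCD qpolyCN. Qed.
Fact dualC_monoid_morphism : monoid_morphism dualC.
Proof. by split=> // a b; exact: qpolyCM. Qed.
HB.instance Definition _ :=
  GRing.isZmodMorphism.Build R dual dualC dualC_zmod_morphism.
HB.instance Definition _ :=
  GRing.isMonoidMorphism.Build R dual dualC dualC_monoid_morphism.

Implicit Types x y : dual.

Definition re (x : dual) : R := (x : {poly R})`_0.
Definition im (x : dual) : R := (x : {poly R})`_1.

Lemma in_dual_coef (p : {poly R}) i :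
  (in_qpoly 'X^2 p : {poly R})`_i = if (i < 2)%N then p`_i else 0.
Proof. by rewrite /= mk_monic_Xn -take_poly_rmodp coef_take_poly. Qed.

Lemma dualP x y : re x = re y -> im x = im y -> x = y.
Proof.
move=> e0 e1; apply: val_inj; apply/polyP => -[|[|i]] //=.
have big (z : dual) : (z : {poly R})`_i.+2 = 0.
  have h : size (mk_monic ('X^2 : {poly R})) = 3.
    by rewrite mk_monic_Xn size_polyXn.
  by apply: nth_default; apply: leq_trans (size_npoly z) _; rewrite h.
by rewrite [LHS]big [RHS]big.
Qed.

Lemma reD x y : re (x + y) = re x + re y. Proof. exact: coefD. Qed.
Lemma imD x y : im (x + y) = im x + im y. Proof. exact: coefD. Qed.

Lemma reM x y : re (x * y) = re x * re y.
Proof. by rewrite /re (in_dual_coef _ 0) coefM big_ord_recl big_ord0 addr0. Qed.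
Lemma imM x y : im (x * y) = re x * im y + im x * re y.
Proof.
by rewrite /im (in_dual_coef _ 1) coefM !big_ord_recl big_ord0 addr0.
Qed.

Lemma re_eps : re eps = 0.
Proof. by rewrite /re (in_dual_coef _ 0) coefX. Qed.
Lemma im_eps : im eps = 1.
Proof. by rewrite /im (in_dual_coef _ 1) coefX. Qed.
Lemma re_dualC a : re (dualC a) = a. Proof. by rewrite /re coefC. Qed.
Lemma im_dualC a : im (dualC a) = 0. Proof. by rewrite /im coefC. Qed.
Lemma re1 : re 1 = 1. Proof. exact: (re_dualC 1). Qed.
Lemma im1 : im 1 = 0. Proof. exact: (im_dualC 1). Qed.

Definition dualE := (re1, im1, reM, imM, reD, imD, re_eps, im_eps, re_dualC, im_dualC).

Lemma lreg_dual x : GRing.lreg x <-> GRing.lreg (re x).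
Proof.
split=> reg => [a b e|y z e].
  suff /(congr1 im) : eps * dualC a = eps * dualC b.
    by rewrite !dualE !mul0r !add0r !mul1r.
  by apply: reg; apply: dualP; rewrite !dualE; [ring|ring: e].
have e0 : re y = re z by apply: reg; rewrite -!reM e.
apply: dualP => //; apply: reg; apply: (addIr (im x * re y)).
by rewrite -imM e imM e0.
Qed.

End Dual.

Section DualMap.
Variables (R S : comNzRingType) (f : {rmorphism R -> S}).

Definition dual_map (x : dual R) : dual S :=
  dualC (f (re x)) + eps S * dualC (f (im x)).

Lemma re_dual_map x : re (dual_map x) = f (re x).
Proof. by rewrite !dualE; ring. Qed.
Lemma im_dual_map x : im (dual_map x) = f (im x).
Proof. by rewrite !dualE; ring. Qed.

Fact dual_map_zmod_morphism : zmod_morphism dual_map.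
Proof.
move=> x y; apply: (addIr (dual_map y)); rewrite subrK.
by apply: dualP; rewrite !(dualE, re_dual_map, im_dual_map) -rmorphD
  -?reD -?imD subrK.
Qed.
Fact dual_map_monoid_morphism : monoid_morphism dual_map.
Proof.
split=> [|x y]; apply: dualP; rewrite !(dualE, re_dual_map, im_dual_map).
- exact: rmorph1.
- exact: rmorph0.
- exact: rmorphM.
by rewrite rmorphD !rmorphM.
Qed.
HB.instance Definition _ :=
  GRing.isZmodMorphism.Build (dual R) (dual S) dual_map dual_map_zmod_morphism.
HB.instance Definition _ :=
  GRing.isMonoidMorphism.Build (dual R) (dual S) dual_map
    dual_map_monoid_morphism.

End DualMap.

Section DualTotalQuotient.
Variables (R : comNzRingType) (Q : totalQuotient R).

Let i := dual_map (tq_map Q).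

Lemma dual_tq_inj : injective i.
Proof.
move=> x y e; apply: dualP; apply: (@tq_inj _ Q).
  by rewrite -!re_dual_map -/i e.
by rewrite -!im_dual_map -/i e.
Qed.

Lemma dual_tq_unit (s : dual R) : GRing.lreg s -> exists u, i s * u = 1.
Proof.
move=> /lreg_dual/(@tq_unit _ Q) [u su].
exists (dualC u + eps Q * dualC (- (u * u * tq_map Q (im s)))).
apply: dualP; rewrite !(dualE, re_dual_map, im_dual_map).
  by ring: su.
by ring: su.
Qed.

Lemma dual_tq_frac (t : dual Q) : exists a s,
  GRing.lreg s /\ t * i s = i a.
Proof.
have [a0 [s0 [r0 e0]]] := @tq_frac _ Q (re t).
have [a1 [s1 [r1 e1]]] := @tq_frac _ Q (im t).
exists (dualC (a0 * s1) + eps R * dualC (a1 * s0)), (dualC (s0 * s1)); split.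
  by apply/lreg_dual; rewrite re_dualC; apply: lregM.
apply: dualP; rewrite !(dualE, re_dual_map, im_dual_map) ?rmorph0 ?rmorphD.
  by rewrite !(rmorphM, rmorph0); ring: e0.
by rewrite !(rmorphM, rmorph0, rmorph1); ring: e1.
Qed.

(* The total quotient ring of R[eps] is T(R)[eps]. *)
Definition dual_tq : totalQuotient (dual R) :=
  TotalQuotient dual_tq_inj dual_tq_unit dual_tq_frac.

End DualTotalQuotient.

(* A, as a subset of T(A) *)
Definition ringof (A : comNzRingType) (T : totalQuotient A) : set T :=
  range (tq_map T).
Arguments ringof {A} T _.

(* R, as a subset of T(R[eps]) *)
Definition baseof (R : comNzRingType) (T : totalQuotient R) :
    set (dual_tq T) :=
  range (fun a : R => tq_map (dual_tq T) (dualC a)).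
Arguments baseof {R} T _.

(* Int^(k)(E, A) and Int^(oo)(E, A); Int^(k)(A) is IntD k (ringof T). *)
Section IntegerValued.
Variables (A : comNzRingType) (T : totalQuotient A).

Definition IntD (k : nat) (E : set T) : set {poly T} :=
  [set f | forall j, (j <= k)%N ->
    [set f^`(j).[x] | x in E] `<=` ringof T].

Definition IntDoo (E : set T) : set {poly T} := \bigcap_k IntD k E.

End IntegerValued.

(* B + C eps, inside T[eps][X] = T[X] + T[X] eps *)
Definition dual_sum (T : comNzRingType) (B C : set {poly T}) :
    set {poly (dual T)} :=
  [set map_poly (@dualC T) f + eps T *: map_poly (@dualC T) g
    | f in B & g in C].

Definition dual_set (T : comNzRingType) (B : set {poly T}) :
    set {poly (dual T)} := dual_sum B B.

(* Main.v *)
Require Import Defs.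
From HB Require Import structures.
From mathcomp Require Import all_boot all_order all_algebra.
From mathcomp Require Import boolp classical_sets.
From mathcomp Require Import ring.

Set Implicit Arguments.
Unset Strict Implicit.
Unset Printing Implicit Defensive.

Import GRing.Theory.

Local Open Scope classical_set_scope.
Local Open Scope ring_scope.

(** Every polynomial over T(R)[eps] is uniquely F = f + eps g with f and g over
    T(R), and F^(j) = f^(j) + eps g^(j). Since eps^2 = 0, Taylor's formula stops
    after the linear term, so that
      F^(j)(a + b eps) = f^(j)(a) + (g^(j)(a) + b f^(j+1)(a)) eps.
    Such a value lies in R[eps] exactly when both of its components lie in R.
    On R we have b = 0, and F is integer-valued with its derivatives up to order
    k if and only if f and g are ([IntD_baseofP]). On R[eps] the values b = 0
    and b = 1 together show that, given the condition on g, the extra condition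
    is that f^(j+1) maps R into R for j <= k: one more derivative of f
    ([IntD_ringofP]). For k infinite the shift by one disappears, and
    both descriptions agree ([IntDoo_baseofP], [IntDoo_ringofP]). *)

Section DualPolynomials.
Variable T : comNzRingType.
Implicit Types (f g : {poly T}) (x : dual T) (F : {poly (dual T)}).

Definition dual_poly f g : {poly (dual T)} :=
  map_poly (@dualC T) f + eps T *: map_poly (@dualC T) g.

Lemma re0 : re (0 : dual T) = 0.
Proof. by rewrite -(rmorph0 (@dualC T)) re_dualC. Qed.

Lemma im0 : im (0 : dual T) = 0.
Proof. by rewrite -(rmorph0 (@dualC T)) im_dualC. Qed.

Lemma re_coef_dual_poly f g i : re (dual_poly f g)`_i = f`_i.
Proof. by rewrite coefD coefZ !coef_map !dualE mul0r addr0. Qed.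

Lemma im_coef_dual_poly f g i : im (dual_poly f g)`_i = g`_i.
Proof. by rewrite coefD coefZ !coef_map !dualE; ring. Qed.

Lemma dual_poly_surj F : exists f g, F = dual_poly f g.
Proof.
exists (map_poly (@re T) F), (map_poly (@im T) F).
apply/polyP => i; apply: dualP.
  by rewrite re_coef_dual_poly coef_map_id0 ?re0.
by rewrite im_coef_dual_poly coef_map_id0 ?im0.
Qed.

Lemma dual_poly_inj f g f' g' :
  dual_poly f g = dual_poly f' g' -> f = f' /\ g = g'.
Proof.
move=> e; split; apply/polyP => i.
  by rewrite -(re_coef_dual_poly f g) e re_coef_dual_poly.
by rewrite -(im_coef_dual_poly f g) e im_coef_dual_poly.
Qed.

Lemma derivn_dual_poly f g j :
  (dual_poly f g)^`(j) = dual_poly f^`(j) g^`(j).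
Proof. by rewrite derivnD derivnZ !derivn_map. Qed.

Lemma re_horner_dualC f x : re (map_poly (@dualC T) f).[x] = f.[re x].
Proof.
elim/poly_ind: f => [|f c ih]; first by rewrite rmorph0 !horner0 re0.
by rewrite rmorphD rmorphM /= map_polyX map_polyC !hornerE !dualE ih.
Qed.

(** The linear term of the Taylor expansion, the only one that survives
    eps^2 = 0; it is what turns a condition on the values of F into a condition
    on the next derivative of f. *)
Lemma im_horner_dualC f x :
  im (map_poly (@dualC T) f).[x] = im x * f^`().[re x].
Proof.
elim/poly_ind: f => [|f c ih].
  by rewrite rmorph0 deriv0 !horner0 im0 mulr0.
rewrite rmorphD rmorphM /= map_polyX map_polyC derivD derivM derivX derivC.
by rewrite !hornerE !dualE ih re_horner_dualC; ring.
Qed.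

Lemma re_horner_dual_poly f g x : re (dual_poly f g).[x] = f.[re x].
Proof. by rewrite hornerD hornerZ !dualE re_horner_dualC mul0r addr0. Qed.

Lemma im_horner_dual_poly f g x :
  im (dual_poly f g).[x] = g.[re x] + im x * f^`().[re x].
Proof.
by rewrite hornerD hornerZ !dualE re_horner_dualC im_horner_dualC; ring.
Qed.

Lemma dual_sumP (B C : set {poly T}) f g :
  dual_sum B C (dual_poly f g) <-> B f /\ C g.
Proof.
split=> [[f' Bf' [g' Cg' /dual_poly_inj [<- <-]]] //|[Bf Cg]].
by exists f => //; exists g.
Qed.

(** Two sets of polynomials over the dual numbers may be compared on the
    normal form f + eps g alone. *)
Lemma dual_poly_ext (P Q : set {poly (dual T)}) :
  (forall f g, P (dual_poly f g) <-> Q (dual_poly f g)) -> P = Q.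
Proof.
move=> PQ; apply/funext => F; apply/propext.
by have [f [g ->]] := dual_poly_surj F.
Qed.

End DualPolynomials.

Section DualIntegerValued.
Variables (R : comNzRingType) (T : totalQuotient R).
Implicit Types (f g : {poly T}) (y : dual T) (a b : T).

Lemma ringof_dualP y :
  ringof (dual_tq T) y <-> ringof T (re y) /\ ringof T (im y).
Proof.
split=> [[x _ <-]|[[c _ ec] [d _ ed]]].
  split; [exists (re x)|exists (im x)] => //.
    by rewrite re_dual_map.
  by rewrite im_dual_map.
exists (dualC c + eps R * dualC d) => //; apply: dualP.
  by rewrite re_dual_map !dualE -ec; congr (tq_map T _); ring.
by rewrite im_dual_map !dualE -ed; congr (tq_map T _); ring.
Qed.

Lemma baseofP y : baseof T y <-> ringof T (re y) /\ im y = 0.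
Proof.
split=> [[c _ <-]|[[c _ ec] i0]].
  rewrite re_dual_map im_dual_map !dualE rmorph0.
  by split=> //; exists c.
exists c => //; apply: dualP; rewrite ?re_dual_map ?im_dual_map !dualE ?ec //.
by rewrite rmorph0 i0.
Qed.

Lemma ringof0 : ringof T 0.
Proof. by exists 0 => //; rewrite rmorph0. Qed.

Lemma ringof1 : ringof T 1.
Proof. by exists 1 => //; rewrite rmorph1. Qed.

Lemma ringofD a b : ringof T a -> ringof T b -> ringof T (a + b).
Proof. by move=> [c _ <-] [d _ <-]; exists (c + d) => //; rewrite rmorphD. Qed.

Lemma ringofN a : ringof T a -> ringof T (- a).
Proof. by move=> [c _ <-]; exists (- c) => //; rewrite rmorphN. Qed.

Lemma ringofM a b : ringof T a -> ringof T b -> ringof T (a * b).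
Proof. by move=> [c _ <-] [d _ <-]; exists (c * d) => //; rewrite rmorphM. Qed.

Lemma IntDP (A : comNzRingType) (Q : totalQuotient A) k (E : set Q) h :
  IntD k E h <->
  (forall j, (j <= k)%N -> forall x, E x -> ringof Q h^`(j).[x]).
Proof.
split=> [H j jk x Ex|H j jk _ [x Ex <-]]; last exact: H.
by apply: (H j jk); exists x.
Qed.

Lemma IntD_baseofP k f g :
  IntD k (baseof T) (dual_poly f g) <->
  IntD k (ringof T) f /\ IntD k (ringof T) g.
Proof.
rewrite !IntDP; split=> [H|[Hf Hg] j jk y /baseofP [Ry i0]].
  have {}H j a : (j <= k)%N -> ringof T a ->
      ringof T f^`(j).[a] /\ ringof T g^`(j).[a].
    move=> jk Ra; have /(H j jk) : baseof T (dualC a).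
      by apply/baseofP; rewrite !dualE.
    rewrite derivn_dual_poly => /ringof_dualP.
    by rewrite re_horner_dual_poly im_horner_dual_poly !dualE mul0r addr0.
  by split=> j jk a Ra; case: (H j a jk Ra).
rewrite derivn_dual_poly; apply/ringof_dualP.
rewrite re_horner_dual_poly im_horner_dual_poly i0 mul0r addr0.
by split; [apply: Hf | apply: Hg].
Qed.

(** The coefficient of eps in F^(j)(a + b eps) is g^(j)(a) + b f^(j+1)(a), so
    letting b vary reaches the derivative of f of order k + 1, but none of g
    beyond order k. *)
Lemma IntD_ringofP k f g :
  IntD k (ringof (dual_tq T)) (dual_poly f g) <->
  IntD k.+1 (ringof T) f /\ IntD k (ringof T) g.
Proof.
rewrite !IntDP; split=> [H|[Hf Hg] j jk y /ringof_dualP [Rre Rim]].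
  have {}H j a b : (j <= k)%N -> ringof T a -> ringof T b ->
      ringof T f^`(j).[a] /\ ringof T (g^`(j).[a] + b * f^`(j.+1).[a]).
    move=> jk Ra Rb.
    have /(H j jk) : ringof (dual_tq T) (dualC a + eps T * dualC b).
      apply/ringof_dualP; rewrite !dualE.
      by rewrite !(mul0r, mul1r, addr0, add0r).
    rewrite derivn_dual_poly => /ringof_dualP.
    rewrite re_horner_dual_poly im_horner_dual_poly derivnS !dualE.
    by rewrite !(mul0r, mul1r, addr0, add0r).
  have Hg j a : (j <= k)%N -> ringof T a -> ringof T g^`(j).[a].
    by move=> jk Ra; have [_] := H j a 0 jk Ra ringof0; rewrite mul0r addr0.
  split=> [[|j] jk a Ra|j jk a Ra]; last exact: Hg.
    by have [] := H 0 a 0 isT Ra ringof0.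
  (* Subtract the value of F^(j) at a from its value at a + eps. *)
  have [_] := H j a 1 jk Ra ringof1; rewrite mul1r => Rgf.
  by rewrite -[X in ringof T X](addKr g^`(j).[a]); apply: ringofD => //;
    apply/ringofN/Hg.
rewrite derivn_dual_poly; apply/ringof_dualP.
rewrite re_horner_dual_poly im_horner_dual_poly -derivnS.
split; first by apply: Hf => //; apply: leqW.
by apply: ringofD; [apply: Hg | apply: ringofM => //; apply: Hf].
Qed.

Lemma IntDooP (A : comNzRingType) (Q : totalQuotient A) (E : set Q) h :
  IntDoo E h <-> forall k, IntD k E h.
Proof. by split=> [H k|H k _]; exact: H. Qed.

Lemma IntDoo_baseofP f g :
  IntDoo (baseof T) (dual_poly f g) <->
  IntDoo (ringof T) f /\ IntDoo (ringof T) g.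
Proof.
rewrite !IntDooP; split=> [H|[Hf Hg] k]; last exact/IntD_baseofP.
by split=> k; have /IntD_baseofP [] := H k.
Qed.

(** When all orders are allowed, the extra derivative required of f at order k
    is already among the conditions at order k + 1. *)
Lemma IntDoo_ringofP f g :
  IntDoo (ringof (dual_tq T)) (dual_poly f g) <->
  IntDoo (ringof T) f /\ IntDoo (ringof T) g.
Proof.
rewrite !IntDooP; split=> [H|[Hf Hg] k]; last exact/IntD_ringofP.
split=> k; have /IntD_ringofP [Hf Hg] := H k => //.
by move=> j jk; apply: Hf; apply: leqW.
Qed.

End DualIntegerValued.

Theorem corollary1p2 (R : comNzRingType) (T : totalQuotient R) :
  (forall k : nat,
      IntD k (baseof T) = dual_set (IntD k (ringof T))
      /\ IntD k (ringof (dual_tq T))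
         = dual_sum (IntD k.+1 (ringof T)) (IntD k (ringof T)))
  /\ (IntDoo (baseof T) = IntDoo (ringof (dual_tq T))
      /\ IntDoo (ringof (dual_tq T)) = dual_set (IntDoo (ringof T))).
Proof.
split=> [k|]; split; apply: dual_poly_ext => f g.
- by rewrite IntD_baseofP /dual_set dual_sumP.
- by rewrite IntD_ringofP dual_sumP.
- by rewrite IntDoo_baseofP IntDoo_ringofP.
- by rewrite IntDoo_ringofP /dual_set dual_sumP.
Qed.
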